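(* Assume $H\le A_{\min}^{1/2}/(\sqrt2\,C_PV_{\max}k)$ and let $f\in L^2(\Omega)$. Then $$\|u^{\mathsf b}\|_{\mathcal H(\Omega)}\le\frac{3C_P}{A_{\min}^{1/2}}\,H\,\|f\|_{L^2(\Omega)} .$$
   Context: $\Omega\subset\mathbb R^d$ ($d=2$ is the paper's focus) is a bounded domain with Lipschitz boundary $\Gamma=\Gamma_D\cup\Gamma_N\cup\Gamma_R$ (disjoint parts); $k>0$ is real. $A,\beta,V$ are real functions with $0<A_{\min}\le A\le A_{\max}$, $0<\beta_{\min}\le\beta\le\beta_{\max}$, $0<V_{\min}\le V\le V_{\max}$. Functions are complex valued. $\mathcal H(\Omega)=\{u\in H^1(\Omega):u|_{\Gamma_D}=0\}$ with $\|u\|_{\mathcal H(\Omega)}^2=\int_\Omega A|\nabla u|^2+k^2V^2|u|^2$. $T_ku=0$ on $\Gamma_N$, $T_ku=ik\beta u$ on $\Gamma_R$. $\mathcal T_H$ is a shape regular, uniform partition of $\Omega$ into elements (such as triangles or quadrilaterals), each connected component of $\Omega$ containing at least two elements, with $\max_T\operatorname{diam}T=H$, $\min_T\operatorname{diam}T\ge c_0H$, $\operatorname{diam}(T)^d/|T|\le c_1$. $C_P$ is a constant depending only on $c_0,c_1,d$ with $\|v\|_{L^2(T)}\le C_PH\|\nabla v\|_{L^2(T)}$ for all $T\in\mathcal T_H$ and $v\in H^1(T)$ vanishing on one edge of $T$. The bubble part $u^{\mathsf b}\in\mathcal H(\Omega)$ is defined by $u^{\mathsf b}=u_T^{\mathsf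 b}$ in each $T\in\mathcal T_H$, where $u_T^{\mathsf b}$ is the weak solution of $-\nabla\cdot(A\nabla u_T^{\mathsf b})-k^2V^2u_T^{\mathsf b}=f$ in $T$, $u_T^{\mathsf b}=0$ on $\partial T\setminus(\Gamma_N\cup\Gamma_R)$, $A\nabla u_T^{\mathsf b}\cdot\nu=T_ku_T^{\mathsf b}$ on $\partial T\cap(\Gamma_N\cup\Gamma_R)$. *)

(* Defs.v *)
From HB Require Import structures.
From mathcomp Require Import all_boot all_order all_algebra.
From mathcomp Require Import all_classical all_reals all_analysis.
From mathcomp Require Import complex.
Import Order.TTheory GRing.Theory Num.Theory.
Import numFieldNormedType.Exports.

Set Implicit Arguments.
Unset Strict Implicit.
Unset Printing Implicit Defensive.

Local Open Scope classical_set_scope.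
Local Open Scope ring_scope.

Definition rV_display : measure_display. Proof. exact: default_measure_display. Qed.

Section rV_measurable.
Context (R : realType) (n : nat).

(* the Borel sigma-algebra, generated by the coordinates as for n.-tuple;
   every L^2 class has a Borel representative *)
Definition rV_measurable : set (set 'rV[R]_n) :=
  g_sigma_preimage (fun (i : 'I_n) (x : 'rV[R]_n) => x ord0 i).

Let rV_measurable0 : rV_measurable set0.
Proof. exact: sigma_algebra0. Qed.

Let rV_measurableC A : rV_measurable A -> rV_measurable (~` A).
Proof. exact: sigma_algebraC. Qed.

Let rV_measurable_bigcup (F : (set 'rV[R]_n)^nat) :
  (forall i, rV_measurable (F i)) -> rV_measurable (\bigcup_i F i).
Proof. exact: sigma_algebra_bigcup. Qed.

HB.instance Definition _ := @isMeasurable.Build rV_display 'rV[R]_n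
  rV_measurable rV_measurable0 rV_measurableC rV_measurable_bigcup.

End rV_measurable.

Section rV_cons.
Context (R : realType) (n : nat).

Lemma measurable_coord (i : 'I_n) :
  measurable_fun [set: 'rV[R]_n] (fun x : 'rV[R]_n => x ord0 i).
Proof.
move=> _ Y mY; rewrite setTI; apply: sub_sigma_algebra => /=.
rewrite -bigcup_seq/=; exists i => /=; first by rewrite mem_index_enum.
by exists Y => //; rewrite setTI.
Qed.

Lemma measurable_fun_coordP d (T : measurableType d) (f : T -> 'rV[R]_n) :
  (forall i, measurable_fun [set: T] (fun t => f t ord0 i)) ->
  measurable_fun [set: T] f.
Proof.
move=> mf _ Y mY; rewrite setTI.
suff : measurable `<=` [set B : set 'rV[R]_n | measurable (f @^-1` B)].
  exact.
apply: smallest_sub.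
  split=> /=.
  - by rewrite preimage_set0.
  - by move=> B mB; rewrite setTD preimage_setC; exact: measurableC.
  - by move=> F mF; rewrite preimage_bigcup; exact: bigcup_measurable.
move=> B; rewrite -bigcup_seq/= => -[i _] [C mC <-] /=.
by rewrite setTI; have := mf i measurableT C mC; rewrite setTI.
Qed.

Definition rVcons (p : R * 'rV[R]_n) : 'rV[R]_n.+1 :=
  \row_i oapp (fun j => p.2 ord0 j) p.1 (unlift ord0 i).

Definition rVsplit (x : 'rV[R]_n.+1) : R * 'rV[R]_n :=
  (x ord0 ord0, \row_j x ord0 (lift ord0 j)).

Lemma rVconsK : cancel rVcons rVsplit.
Proof.
move=> [a x]; rewrite /rVsplit /rVcons !mxE unlift_none/=; congr pair.
by apply/rowP => j; rewrite !mxE liftK.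
Qed.

End rV_cons.

Lemma measurable_rVcons (R : realType) n :
  measurable_fun [set: R * 'rV[R]_n] (@rVcons R n).
Proof.
apply: measurable_fun_coordP => i; rewrite /rVcons.
case: (unliftP ord0 i) => [j|] ->.
  under eq_fun do rewrite mxE liftK/=.
  exact: (measurableT_comp (@measurable_coord R n j)).
by under eq_fun do rewrite mxE unlift_none/=; exact: measurable_fst.
Qed.

Lemma measurable_rVsplit (R : realType) n :
  measurable_fun [set: 'rV[R]_n.+1] (@rVsplit R n).
Proof.
apply/measurable_fun_pairP; split; first exact: measurable_coord.
apply: measurable_fun_coordP => i /=.
by under eq_fun do rewrite mxE; exact: measurable_coord.
Qed.

Lemma sigma_finite_product d1 d2 (T1 : measurableType d1)
    (T2 : measurableType d2) (R : realType)
    (m1 : {sigma_finite_measure set T1 -> \bar R})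
    (m2 : {sigma_finite_measure set T2 -> \bar R}) :
  sigma_finite setT (m1 \x m2)%E.
Proof.
have /sigma_finiteP[F [TF ndF Foo]] := sigma_finiteT m1.
have /sigma_finiteP[G [TG ndG Goo]] := sigma_finiteT m2.
exists (fun n => F n `*` G n).
  rewrite -setXTT TF TG predeqE => -[x y]; split.
    move=> [/= [n _ Fnx] [k _ Gky]]; exists (maxn n k) => //; split.
    - by move: x Fnx; exact/subsetPset/ndF/leq_maxl.
    - by move: y Gky; exact/subsetPset/ndG/leq_maxr.
  by move=> [n _ []/= ? ?]; split; exists n.
move=> k; have [? ?] := Foo k; have [? ?] := Goo k.
split; first exact: measurableX.
by rewrite product_measure1E// lte_mul_pinfty// ge0_fin_numE.
Qed.

Section lebesgue_rV_step.
Context (R : realType) (n : nat).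
Context (mu : {sigma_finite_measure set 'rV[R]_n -> \bar R}).
Local Open Scope ereal_scope.

Definition lebesgue_rV_step : set 'rV[R]_n.+1 -> \bar R :=
  pushforward (@lebesgue_measure R \x mu) (@rVcons R n).

Let preimage_rVcons (B : set 'rV[R]_n.+1) :
  measurable B -> measurable (@rVcons R n @^-1` B).
Proof.
by move=> mB; rewrite -[X in measurable X]setTI; exact: measurable_rVcons.
Qed.

Let step0 : lebesgue_rV_step set0 = 0.
Proof. by rewrite /lebesgue_rV_step /pushforward preimage_set0 measure0. Qed.

Let step_ge0 B : 0 <= lebesgue_rV_step B.
Proof. exact: (measure_ge0 (@lebesgue_measure R \x mu)). Qed.

Let step_sigma_additive : semi_sigma_additive lebesgue_rV_step.
Proof.
move=> F mF tF mUF; rewrite /lebesgue_rV_step /pushforward preimage_bigcup.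
apply: (measure_semi_sigma_additive (s := @lebesgue_measure R \x mu)).
- by move=> i; exact: preimage_rVcons.
- apply/trivIsetP => /= i j _ _ ij; rewrite -preimage_setI.
  by move/trivIsetP : tF => /(_ _ _ _ _ ij) ->//; rewrite preimage_set0.
- by rewrite -preimage_bigcup; exact: preimage_rVcons.
Qed.

HB.instance Definition _ := isMeasure.Build _ _ _
  lebesgue_rV_step step0 step_ge0 step_sigma_additive.

Let step_sigma_finite : sigma_finite setT lebesgue_rV_step.
Proof.
have [F FT Foo] : sigma_finite setT (@lebesgue_measure R \x mu).
  exact: sigma_finite_product.
exists (fun i => @rVsplit R n @^-1` F i).
  by rewrite -preimage_bigcup -FT preimage_setT.
move=> i; have [mFi Fioo] := Foo i; split.
  by rewrite -[X in measurable X]setTI; exact: measurable_rVsplit.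
rewrite /lebesgue_rV_step /pushforward -comp_preimage.
by rewrite (_ : _ \o _ = id)//; apply/funext => p /=; rewrite rVconsK.
Qed.

HB.instance Definition _ := Measure_isSigmaFinite.Build _ _ _
  lebesgue_rV_step step_sigma_finite.

End lebesgue_rV_step.

Fixpoint lebesgue_rV (R : realType) (n : nat) :
    {sigma_finite_measure set 'rV[R]_n -> \bar R} :=
  match n with
  | 0 => [the {sigma_finite_measure set 'rV[R]_0 -> \bar R} of \d_(0 : 'rV[R]_0)]
  | n'.+1 => [the {sigma_finite_measure set 'rV[R]_n'.+1 -> \bar R} of
               lebesgue_rV_step (lebesgue_rV R n')]
  end.

Section hausdorff.
Context (R : realType) (n : nat).
Implicit Types (x y : 'rV[R]_n) (U A : set 'rV[R]_n) (s : nat) (e : R).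

Definition dotrV x y : R := \sum_j x ord0 j * y ord0 j.

(* the norm `|x| of 'rV[R]_n is the max norm *)
Definition enorm x : R := Num.sqrt (dotrV x x).

(* -oo on the empty set *)
Definition ediam U : \bar R :=
  ereal_sup [set (enorm (p.1 - p.2))%:E | p in U `*` U].

Definition diam U : R := fine (ediam U).

End hausdorff.

Section hausdorff_measure.
Context (R : realType) (n s : nat).
Implicit Types (U A : set 'rV[R]_n) (e : R).
Local Open Scope ereal_scope.

(* omega_s / 2^s, with omega_s the volume of the unit ball of R^s: with this
   factor the s-dimensional Hausdorff measure is the s-dimensional area *)
Definition hausdorff_factor : R :=
  fine (lebesgue_rV R s [set x | (enorm x <= 1)%R]) / 2 ^+ s.

Definition hausdorff_gauge e U : \bar R :=
  if `[< U = set0 >] then 0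
  else if ediam U <= e%:E then (hausdorff_factor * diam U ^+ s)%:E else +oo.

(* mu_ext takes the infimum over countable covers by measurable sets, which is
   no restriction since a set and its closure have the same diameter *)
Definition hausdorff A : \bar R :=
  ereal_sup [set mu_ext (hausdorff_gauge e) A | e in [set e | (0 < e)%R]].

Let diam_ge0 U : (0 <= diam U)%R.
Proof.
rewrite /diam; have [->|/set0P[x Ux]] := eqVneq U set0.
  by rewrite /ediam setX0 image_set0 ereal_sup0.
apply: fine_ge0; apply: ereal_sup_ubound; exists (x, x) => //=.
rewrite subrr /enorm /dotrV big1 ?sqrtr0// => j _.
by rewrite mxE mul0r.
Qed.

Let gauge0 e : hausdorff_gauge e set0 = 0.
Proof. by rewrite /hausdorff_gauge asboolT. Qed.

Let gauge_ge0 e U : 0 <= hausdorff_gauge e U.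
Proof.
rewrite /hausdorff_gauge; case: ifP => // _; case: ifP => // _.
rewrite lee_fin mulr_ge0 ?exprn_ge0// divr_ge0 ?exprn_ge0//.
by apply: fine_ge0; exact: measure_ge0.
Qed.

Let hausdorff0 : hausdorff set0 = 0.
Proof.
rewrite /hausdorff (_ : [set _ | _ in _] = [set 0]) ?ereal_sup1//.
apply/seteqP; split => [_ [e _ <-]|_ ->] /=.
  by rewrite mu_ext0.
by exists 1%R => //=; rewrite mu_ext0.
Qed.

Let hausdorff_ge0 A : 0 <= hausdorff A.
Proof.
apply: (@le_trans _ _ (mu_ext (hausdorff_gauge 1) A)).
  exact: mu_ext_ge0.
by apply: ereal_sup_ubound; exists 1%R => //=.
Qed.

Let le_hausdorff : {homo hausdorff : A B / A `<=` B >-> A <= B}.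
Proof.
move=> A B AB; apply: ge_ereal_sup => _ [e e0 <-].
apply: (@le_trans _ _ (mu_ext (hausdorff_gauge e) B)).
  exact: le_mu_ext.
by apply: ereal_sup_ubound; exists e.
Qed.

Let hausdorff_sigma_subadditive : sigma_subadditive hausdorff.
Proof.
move=> F; apply: ge_ereal_sup => _ [e e0 <-].
have /le_trans := mu_ext_sigma_subadditive (@gauge_ge0 e) F.
apply; apply: lee_nneseries => [i _ _|i _].
  exact: mu_ext_ge0.
by apply: ereal_sup_ubound; exists e.
Qed.

HB.instance Definition _ := isOuterMeasure.Build R 'rV[R]_n hausdorff
  hausdorff0 hausdorff_ge0 le_hausdorff hausdorff_sigma_subadditive.

End hausdorff_measure.

Section domains.
Context (R : realType) (d : nat).
Local Notation Rd := 'rV[R]_d.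

Definition bdry (D : set Rd) : set Rd := closure D `\` interior D.

(* Near each boundary point, in the direction of a unit vector nu, D is the
   strict epigraph of a Lipschitz function of the component orthogonal to nu. *)
Definition lipschitz_boundary (D : set Rd) : Prop :=
  forall x, bdry D x ->
  exists (U : set Rd) (nu : Rd) (L : R) (gamma : Rd -> R),
    [/\ open U, U x, enorm nu = 1,
        forall y z, `|gamma y - gamma z| <= L * enorm (y - z) &
        D `&` U = [set y | U y /\
                    gamma (y - dotrV y nu *: nu) < dotrV y nu]].

Definition hausdorff_bdry : {outer_measure set Rd -> \bar R} :=
  [the {outer_measure set Rd -> \bar R} of @hausdorff R d d.-1].

(* a copy of R^d: hausdorff_bdry is a measure on its Caratheodory sets *)
Definition surface_type : Type := caratheodory_type hausdorff_bdry.

HB.instance Definition _ := Measurable.on surface_type.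

Definition surface : {measure set surface_type -> \bar R} :=
  [the {measure set (caratheodory_type hausdorff_bdry) -> \bar R} of
    (hausdorff_bdry : set (caratheodory_type hausdorff_bdry) -> \bar R)].

End domains.

Local Notation Re := complex.Re.
Local Notation Im := complex.Im.
Local Notation normc := Normc.normc.

Section cintegral.
Context dd (T : measurableType dd) (R : realType).
Implicit Types (mu : {measure set T -> \bar R}) (D : set T) (f : T -> R[i]).

Definition cmeasurable_fun D f : Prop :=
  measurable_fun D (fun x => Re (f x)) /\ measurable_fun D (fun x => Im (f x)).

Definition cintegral mu D f : R[i] :=
  Complex (\int[mu]_(x in D) Re (f x)) (\int[mu]_(x in D) Im (f x)).

End cintegral.

Section sobolev.
Context (R : realType) (d : nat).
Local Notation Rd := 'rV[R]_d.
Local Notation leb := (lebesgue_rV R d).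
Implicit Types (D S : set Rd) (u v f : Rd -> R[i]) (G : Rd -> 'rV[R[i]]_d).

Definition sqnormc (w : 'rV[R[i]]_d) : R := \sum_j normc (w ord0 j) ^+ 2.

Definition in_L2 D u : Prop :=
  cmeasurable_fun D u /\ (\int[leb]_(x in D) (normc (u x) ^+ 2)%:E < +oo)%E.

Definition L2norm D u : R :=
  Num.sqrt (\int[leb]_(x in D) (normc (u x) ^+ 2)).

Definition L2norm_grad D G : R :=
  Num.sqrt (\int[leb]_(x in D) sqnormc (G x)).

Definition partial (j : 'I_d) (phi : Rd -> R) : Rd -> R :=
  fun x => 'D_(delta_mx ord0 j) phi x.

Fixpoint Ck (k : nat) (phi : Rd -> R) : Prop :=
  continuous phi /\
  match k with
  | 0 => True
  | k'.+1 => forall j, (forall x, derivable phi x (delta_mx ord0 j)) /\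
                       Ck k' (partial j phi)
  end.

Definition smooth (phi : Rd -> R) : Prop := forall k, Ck k phi.

Definition test_function D (phi : Rd -> R) : Prop :=
  [/\ smooth phi, compact (closure [set x | phi x != 0]) &
      closure [set x | phi x != 0] `<=` D].

(* u is in H^1(D) and has weak gradient G there. Carrying G along with u fixes
   a representative of the gradient. *)
Definition in_H1 D u G : Prop :=
  [/\ in_L2 D u,
      forall j, in_L2 D (fun x => G x ord0 j) &
      forall phi j, test_function D phi ->
        cintegral leb D (fun x => (partial j phi x)%:C%C * u x) =
        - cintegral leb D (fun x => (phi x)%:C%C * G x ord0 j)].

Definition cgrad u : Rd -> 'rV[R[i]]_d := fun x =>
  \row_j Complex (partial j (fun y => Re (u y)) x)
                 (partial j (fun y => Im (u y)) x).

(* g is the boundary trace of the H^1(D) function u: it is the L^2(bdry D)-limit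
   of the boundary values of smooth functions converging to u in H^1(D). *)
Definition is_trace D u G (g : Rd -> R[i]) : Prop :=
  cmeasurable_fun (bdry D : set (surface_type R d)) g /\
  exists phi : nat -> Rd -> R[i],
    [/\ forall n, smooth (fun x => Re (phi n x)) /\
                  smooth (fun x => Im (phi n x)),
        (fun n => \int[leb]_(x in D)
           (normc (phi n x - u x) ^+ 2 + sqnormc (cgrad (phi n) x - G x))%:E)%E
          @ \oo --> 0%E &
        (fun n => \int[surface R d]_(x in (bdry D : set (surface_type R d)))
           (normc (phi n x - g x) ^+ 2)%:E)%E @ \oo --> 0%E].

Definition vanishes_on S (g : Rd -> R[i]) : Prop :=
  surface R d (S `&` [set x | g x != 0]) = 0%E.

Definition energy_norm (Omega : set Rd) (k : R) (A V : Rd -> R) u G : R :=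
  Num.sqrt (\int[leb]_(x in Omega)
    (A x * sqnormc (G x) + k ^+ 2 * V x ^+ 2 * normc (u x) ^+ 2)).

Definition in_HOmega (Omega GammaD : set Rd) u G : Prop :=
  in_H1 Omega u G /\ exists2 g, is_trace Omega u G g & vanishes_on GammaD g.

Definition Tk (k : R) (beta : Rd -> R) (GammaR : set Rd) (g : Rd -> R[i]) :
    Rd -> R[i] :=
  fun x => if `[< GammaR x >] then Complex 0 (k * beta x) * g x else 0.

(* weak form of
     - div (A grad u) - k^2 V^2 u = f       in T,
     u = 0                                  on bdry T \ (GammaN u GammaR),
     A grad u . nu = T_k u                  on bdry T n (GammaN u GammaR);
   the trace gu is unique up to a surface-null set *)
Definition bubble_on (k : R) (A beta V : Rd -> R) (GammaN GammaR : set Rd) f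
    (T : set Rd) u G : Prop :=
  let natural := GammaN `|` GammaR in
  in_H1 T u G /\
  exists gu,
  [/\ is_trace T u G gu,
      vanishes_on (bdry T `\` natural) gu &
      forall v Gv gv,
        in_H1 T v Gv -> is_trace T v Gv gv ->
        vanishes_on (bdry T `\` natural) gv ->
        cintegral leb T (fun x =>
            (A x)%:C%C * (\sum_j G x ord0 j * (Gv x ord0 j)^*%C)
            - (k ^+ 2 * V x ^+ 2)%:C%C * u x * (v x)^*%C)
        - cintegral (surface R d) (bdry T `&` natural : set (surface_type R d))
            (fun x => Tk k beta GammaR gu x * (gv x)^*%C)
        = cintegral leb T (fun x => f x * (v x)^*%C)].

End sobolev.

Section meshes.
Context (R : realType) (d : nat).
Local Notation Rd := 'rV[R]_d.
Implicit Types (Omega T : set Rd) (edges : set (set Rd)).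

(* Elements are open and edges relatively open in the boundary: the vertices
   (faces of codimension at least 2) belong to no edge. *)
Definition is_element T edges : Prop :=
  [/\ [/\ open T, T !=set0, connected T, bounded_set T & lipschitz_boundary T],
      finite_set edges, trivIset edges id,
      forall e, edges e ->
        [/\ e !=set0, connected e & exists2 U, open U & e = U `&` bdry T] &
      surface R d (bdry T `\` \bigcup_(e in edges) e) = 0%E].

(* The elements being open with Lipschitz boundary, the null set condition is
   equivalent to closure Omega = \bigcup_i closure (T i). By the last condition
   every edge is either an interior edge or a boundary edge. *)
Definition is_partition Omega (I : finType) (T : I -> set Rd)
    (E : I -> set (set Rd)) : Prop :=
  [/\ forall i, is_element (T i) (E i),
      forall i, T i `<=` Omega,
      forall i j, i != j -> T i `&` T j = set0,
      lebesgue_rV R d (Omega `\` \bigcup_i T i) = 0%E &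
      forall i e, E i e -> e `<=` Omega \/ e `<=` bdry Omega].

Definition shape_regular_uniform (I : finType) (T : I -> set Rd) (H c0 c1 : R) :
    Prop :=
  [/\ forall i, diam (T i) <= H, exists i, diam (T i) = H,
      forall i, c0 * H <= diam (T i) &
      forall i, diam (T i) ^+ d / fine (lebesgue_rV R d (T i)) <= c1].

Definition components_have_two_elements Omega (I : finType) (T : I -> set Rd) :
    Prop :=
  forall x, Omega x -> exists i j, [/\ i != j,
    T i `<=` connected_component Omega x &
    T j `<=` connected_component Omega x].

Definition poincare_constant (I : finType) (T : I -> set Rd)
    (E : I -> set (set Rd)) (H CP : R) : Prop :=
  forall i e v Gv gv, E i e ->
    in_H1 (T i) v Gv -> is_trace (T i) v Gv gv -> vanishes_on e gv ->
    L2norm (T i) v <= CP * H * L2norm_grad (T i) Gv.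

End meshes.

(* Main.v *)
Require Import Defs.
From mathcomp Require Import all_boot all_order all_algebra.
From mathcomp Require Import all_classical all_reals all_analysis.
From mathcomp Require Import complex measurable_realfun ring lra.
Import Order.TTheory GRing.Theory Num.Theory.
Import numFieldNormedType.Exports.

(** The proof has an analytic part, local to each element T, and a geometric
part, which makes Poincare's inequality available on T.

Analysis. Test the weak form on T with the bubble itself and take real parts.
The impedance term i k beta |u|^2 is imaginary and drops out, which leaves
a - b = Re (f, u), where a = ||A^(1/2) grad u||^2 and b = ||k V u||^2 on T
([bubble_energy_identity]). By Poincare's inequality
||u|| <= C_P H ||grad u||, and the bound on H says precisely that then
b <= a / 2, so that a - b >= a / 2 and the form is coercive on bubbles.
Young's inequality with a weight of order (C_P H)^2 / Amin bounds Re (f, u) by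
a multiple of (C_P H)^2 / Amin ||f||^2 plus a part absorbed in a
([absorption]). This gives a + b <= 9 (C_P H)^2 / Amin ||f||^2 on T
([bubble_energy_le]), and summing over the elements, which cover Omega up to a
null set, gives the square of the claim.

Geometry. Poincare's inequality requires an edge of T on which u vanishes.
Every edge lies in Omega or in its boundary, and u vanishes on the edges in
Omega; so it must be shown that not all edges of T lie in the boundary of Omega
([interior_edge]). If they did, the part of bdry T inside Omega would have
surface measure zero. But T shares a component of Omega with another element,
so by connectedness some point of that component has points of T and exterior
points of T arbitrarily near, within a small cube of Omega. All segments
parallel to the one joining two such points p and q, and close to it, cross
bdry T ([bdry_cube_gt0]). Projecting along q - p, which is Lipschitz, maps
bdry T onto a set containing a cube of dimension d - 1, and this contradicts
the vanishing of its (d - 1)-dimensional Hausdorff measure ([hausdorff_gt0]). *)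

Set Implicit Arguments.
Unset Strict Implicit.
Unset Printing Implicit Defensive.

Local Open Scope classical_set_scope.
Local Open Scope ring_scope.

Local Notation Re := complex.Re.
Local Notation Im := complex.Im.
Local Notation normc := Normc.normc.

(** * Cubes and Lebesgue measure *)

Definition cube (R : realType) n (c : 'rV[R]_n) (r : R) : set 'rV[R]_n :=
  [set x | forall i, `|x ord0 i - c ord0 i| <= r].

Section cubes.
Context (R : realType).

Lemma measurable_cube n (c : 'rV[R]_n) (r : R) : measurable (cube c r).
Proof.
have -> : cube c r =
    \bigcap_(i in [set: 'I_n]) [set x | `|x ord0 i - c ord0 i| <= r].
  by apply/seteqP; split=> [x cx i _|x cx i]; [exact: cx|exact: (cx i)].
apply: fin_bigcap_measurable => // i _.
have mi : measurable_fun [set: 'rV[R]_n] (fun x => `|x ord0 i - c ord0 i|).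
  apply: measurableT_comp => //; apply: measurable_funB => //.
  exact: measurable_coord.
have := mi measurableT `]-oo, r]%classic (measurable_itv _).
by rewrite setTI set_itvE.
Qed.

Lemma lebesgue_cube n (c : 'rV[R]_n) (r : R) : 0 <= r ->
  lebesgue_rV R n (cube c r) = ((2 * r) ^+ n)%:E.
Proof.
move=> r0; elim: n c => [|n IHn] c.
  by rewrite /= diracE mem_set// => -[].
pose c' : 'rV[R]_n := \row_j c ord0 (lift ord0 j).
rewrite /= /lebesgue_rV_step /pushforward.
have -> : @rVcons R n @^-1` cube c r =
    `[c ord0 ord0 - r, c ord0 ord0 + r]%classic `*` cube c' r.
  apply/seteqP; split=> [[a x] /= H|[a x] /= [Ha Hx] i].
    split; first by have := H ord0; rewrite /rVcons mxE unlift_none /= in_itv /=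
      ler_distl.
    by move=> j; have := H (lift ord0 j); rewrite /rVcons mxE liftK /= !mxE.
  rewrite /rVcons; case: (unliftP ord0 i) => [j|] ->.
    by rewrite mxE liftK /=; have := Hx j; rewrite !mxE.
  by rewrite mxE unlift_none /= ler_distl; move: Ha; rewrite in_itv.
rewrite product_measure1E//; last exact: measurable_cube.
rewrite IHn exprS (_ : (lebesgue_measure : {measure set _ -> \bar R}) _ =
  (2 * r)%:E) //.
rewrite [LHS](lebesgue_measure_itv `[_, _]) /= lte_fin.
have -> : (c ord0 ord0 - r < c ord0 ord0 + r) = (0 < r).
  by apply/idP/idP; lra.
move: r0; rewrite le_eqVlt => /predU1P[<-|r0].
  by rewrite ltxx mulr0.
by rewrite r0 -EFinB; congr (_%:E); lra.
Qed.

Lemma open_cube n (U : set 'rV[R]_n) x : open U -> U x ->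
  exists2 r, 0 < r & cube x r `<=` U.
Proof.
move=> oU Ux; have /nbhs_ballP[e /= e0 xeU] : nbhs x U by exact: open_nbhs_nbhs.
exists (e / 2); first by rewrite divr_gt0.
move=> y xy; apply: xeU; split=> // i j; rewrite (ord1 i) /ball /=.
by rewrite distrC; have := xy j; lra.
Qed.

Lemma cube_open_nbhs n (x : 'rV[R]_n) r : 0 < r -> nbhs x (cube x r).
Proof.
move=> r0; apply/nbhs_ballP; exists r => //= y [_ xy] i.
by rewrite distrC; exact: ltW (xy _ _).
Qed.

(** The open sets are generated by the cubes with rational centre and radius
1/(m+1), of which there are countably many. *)
Lemma open_measurable_rV n (U : set 'rV[R]_n) : open U -> measurable U.
Proof.
move=> oU.
pose Q (p : 'rV[rat]_n * nat) : set 'rV[R]_n :=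
  cube (map_mx ratr p.1) p.2.+1%:R^-1.
pose Q' p := if `[< Q p `<=` U >] then Q p else set0.
have -> : U = \bigcup_p Q' p.
  apply/seteqP; split=> [x Ux|x [p _]]; last first.
    by rewrite /Q'; case: asboolP => // sub; exact: sub.
  have [e e0 xeU] := open_cube oU Ux.
  have [|m me] := @ltr_add_invr R 0 (e / 2); first by rewrite divr_gt0.
  have m0 : 0 < m.+1%:R^-1 :> R by rewrite invr_gt0.
  have [s sE] : exists s : R, s = m.+1%:R^-1 by exists m.+1%:R^-1.
  rewrite add0r -sE in me m0.
  have rq i : exists q : rat, `|x ord0 i - ratr q| <= s.
    have [|q] := @rat_in_itvoo R (x ord0 i - s) (x ord0 i + s); first by lra.
    by rewrite in_itv /= => Hq; exists q; rewrite ler_distl; lra.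
  have [q Hq] := choice rq.
  exists (\row_i q i, m) => //=.
  have cqU : Q (\row_i q i, m) `<=` U.
    move=> y yq; apply: xeU => i; have := yq i; have := Hq i.
    by rewrite !mxE !ler_distl /= -sE; lra.
  by rewrite /Q' asboolT // => i; rewrite !mxE /= -sE.
apply: countable_bigcupT_measurable => // p.
by rewrite /Q'; case: ifP => // _; exact: measurable_cube.
Qed.
End cubes.

(** * Lower bounds for the Hausdorff measure *)

Section hausdorff_lower_bound.
Context (R : realType).

Lemma le_enorm n (x : 'rV[R]_n) i : `|x ord0 i| <= enorm x.
Proof.
rewrite -sqrtr_sqr ler_wsqrtr // /dotrV (bigD1 i) //= expr2 lerDl sumr_ge0//.
by move=> j _; rewrite -expr2 sqr_ge0.
Qed.

Lemma enorm0 n : enorm (0 : 'rV[R]_n) = 0.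
Proof. by rewrite /enorm /dotrV big1 ?sqrtr0 // => j _; rewrite mxE mul0r. Qed.

Lemma enorm_le_ediam n (U : set 'rV[R]_n) x y : U x -> U y ->
  ((enorm (x - y))%:E <= ediam U)%E.
Proof. by move=> Ux Uy; apply: ereal_sup_ubound; exists (x, y). Qed.

Lemma ediam_ge0 n (U : set 'rV[R]_n) : U !=set0 -> (0 <= ediam U)%E.
Proof.
by move=> [x Ux]; rewrite -[0%E](congr1 EFin (enorm0 n)) -(subrr x);
  exact: enorm_le_ediam.
Qed.

Lemma diam_ge0 n (U : set 'rV[R]_n) : 0 <= diam U.
Proof.
rewrite /diam; have [->|/set0P U0] := eqVneq U set0.
  by rewrite /ediam setX0 image_set0 ereal_sup0.
by rewrite fine_ge0 // ediam_ge0.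
Qed.

Lemma enorm_le1 n (x : 'rV[R]_n) : (enorm x <= 1) = (dotrV x x <= 1).
Proof. by rewrite /enorm -[in LHS](sqrtr1 R) ler_sqrt. Qed.

Lemma measurable_unit_ball n : measurable [set x : 'rV[R]_n | enorm x <= 1].
Proof.
have mf : measurable_fun [set: 'rV[R]_n] (fun x => dotrV x x).
  apply: measurable_sum => i.
  by apply: measurable_funM; exact: measurable_coord.
have := mf measurableT `]-oo, 1]%classic (measurable_itv _).
rewrite setTI set_itvE; congr measurable; apply/seteqP.
by split=> x /=; rewrite enorm_le1.
Qed.

(** The unit ball lies between two cubes, so its volume is positive and finite;
finiteness matters because the factor is a [fine] value, which would be 0 at
infinity. *)
Lemma hausdorff_factor_gt0 n : 0 < hausdorff_factor R n.
Proof.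
rewrite divr_gt0 ?exprn_gt0 //.
set r : R := n.+1%:R^-1; have r0 : 0 < r by rewrite invr_gt0.
have nr1 : n%:R * r <= 1 by rewrite ler_pdivrMr // mul1r ler_nat.
have r1 : r <= 1 by rewrite invf_le1 // ler1n.
set ball1 := [set x : 'rV[R]_n | enorm x <= 1].
have lower : (((2 * r) ^+ n)%:E <= lebesgue_rV R n ball1)%E.
  rewrite -(lebesgue_cube 0 (ltW r0)) le_measure ?inE //.
  - exact: measurable_cube.
  - exact: measurable_unit_ball.
  move=> x xr; rewrite /ball1 /= enorm_le1 /dotrV.
  apply: (@le_trans _ _ (\sum_(j < n) r)); last first.
    by rewrite sumr_const card_ord -mulr_natl.
  apply: ler_sum => j _; have := xr j; rewrite mxE subr0 => xj.
  rewrite -expr2 -real_normK ?num_real // expr2.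
  by apply: (le_trans _ xj); rewrite ler_piMr // (le_trans xj).
have upper : (lebesgue_rV R n ball1 <= ((2 * 1) ^+ n)%:E)%E.
  rewrite -(lebesgue_cube 0 ler01) le_measure ?inE //.
  - exact: measurable_unit_ball.
  - exact: measurable_cube.
  by move=> x /= x1 i; rewrite mxE subr0 (le_trans (le_enorm _ _)).
apply: fine_gt0; rewrite (le_lt_trans upper) ?ltry // andbT.
by rewrite (lt_le_trans _ lower) // lte_fin exprn_gt0 // mulr_gt0.
Qed.

Section lipschitz.
Context m n (p : 'rV[R]_m -> 'rV[R]_n) (L : R).
Hypothesis L0 : 0 < L.
Hypothesis pL : forall x y i, `|p x ord0 i - p y ord0 i| <= L * enorm (x - y).

Let K := (2 * L) ^+ n / hausdorff_factor R n.

Let K0 : 0 < K.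
Proof. by rewrite divr_gt0 ?hausdorff_factor_gt0// exprn_gt0// mulr_gt0. Qed.

(** A set of diameter delta has its image in a cube of half side L delta, whose
volume is proportional to the gauge delta ^+ n. A set of infinite gauge is
matched by the whole space. *)
Lemma gauge_cover (U : set 'rV[R]_m) : exists B : set 'rV[R]_n,
  [/\ measurable B, p @` U `<=` B &
      (lebesgue_rV R n B <= K%:E * hausdorff_gauge n 1 U)%E].
Proof.
rewrite /hausdorff_gauge; case: asboolP => [->|/eqP/set0P[x Ux]].
  by exists set0; rewrite image_set0 measure0 mule0; split.
case: ifPn => [dU|_]; last first.
  by exists setT; split => //; rewrite gt0_muley ?lte_fin // leey.
have dE : ediam U = (diam U)%:E.
  rewrite fineK // ge0_fin_numE ?(le_lt_trans dU) ?ltry //.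
  by apply: ediam_ge0; exists x.
exists (cube (p x) (L * diam U)); split; first exact: measurable_cube.
  move=> _ [y Uy <-] i; rewrite (le_trans (pL _ _ _)) // ler_pM2l //.
  by rewrite -lee_fin -dE enorm_le_ediam.
rewrite lebesgue_cube ?mulr_ge0 ?diam_ge0 ?(ltW L0) // -EFinM lee_fin.
by rewrite /K [leRHS]mulrA divfK ?gt_eqF ?hausdorff_factor_gt0 // mulrA exprMn.
Qed.

(** Lipschitz maps do not increase Hausdorff measure by more than a factor, and
the n-dimensional measure of a cube is positive. *)
Lemma hausdorff_gt0 (S : set 'rV[R]_m) c r : 0 < r -> cube c r `<=` p @` S ->
  hausdorff n S != 0%E.
Proof.
move=> r0 cS; apply/eqP => S0.
have : (mu_ext (@hausdorff_gauge R m n 1) S < (((2 * r) ^+ n) / K)%:E)%E.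
  apply: (@le_lt_trans _ _ 0%E); last first.
    by rewrite lte_fin divr_gt0 // exprn_gt0 // mulr_gt0.
  by rewrite -S0; apply: ereal_sup_ubound; exists 1 => /=.
move=> /ereal_inf_lt[_ [F [_ SF] <-]] Flt.
have [B HB] := choice (fun k => gauge_cover (F k)).
have : ((((2 * r) ^+ n)%:E : \bar R) <=
    K%:E * \sum_(k <oo) hausdorff_gauge n 1 (F k))%E.
  rewrite -nneseriesZl; last first.
    move=> k _; rewrite /hausdorff_gauge; case: ifP => // _; case: ifP => // _.
    rewrite lee_fin mulr_ge0 ?exprn_ge0 ?(ltW (hausdorff_factor_gt0 _)) //.
    exact: diam_ge0.
  rewrite -(lebesgue_cube c (ltW r0)).
  apply: (@le_trans _ _ (\sum_(k <oo) lebesgue_rV R n (B k))%E).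
    apply: measure_sigma_subadditive => [k||].
    - by have [] := HB k.
    - exact: measurable_cube.
    - move=> x /cS[y Sy <-]; have [k _ Fy] := SF _ Sy.
      by exists k => //; have [_ + _] := HB k; apply; exists y.
  by apply: lee_nneseries => // k _; have [] := HB k.
apply/negP; rewrite -ltNge.
by rewrite muleC -lte_pdivlMr // -EFinM.
Qed.

End lipschitz.
End hausdorff_lower_bound.

(** * Interfaces between elements *)

Section interface.
Context (R : realType).

Lemma open_bdryE d (D : set 'rV[R]_d) : open D -> bdry D = closure D `\` D.
Proof. by move=> /interior_id oD; rewrite /bdry oD. Qed.

(** Otherwise the parameters of the points in D would be open and closed in the
unit interval. *)
Lemma segment_meets_bdry d (D : set 'rV[R]_d) a b : open D -> D a ->
  ~ closure D b -> exists2 s, 0 <= s <= 1 & bdry D (a + s *: (b - a)).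
Proof.
move=> oD Da Db; apply: contrapT => noB.
pose g (s : R) : 'rV[R]_d := a + s *: (b - a).
have cg : continuous g.
  by move=> s; apply: cvgD; [exact: cvg_cst|apply: cvgZr_tmp; exact: cvg_id].
have g0 : g 0 = a by rewrite /g scale0r addr0.
have g1 : g 1 = b by rewrite /g scale1r addrC subrK.
suff /seteqP[_ /(_ 1)] : `[0, 1]%classic `&` g @^-1` D = `[0, 1]%classic.
  rewrite /= in_itv /= lexx ler01 => /(_ isT)[_].
  by rewrite g1 => /subset_closure.
apply: segment_connected.
- by exists 0; split; rewrite /= ?g0 // in_itv /= lexx ler01.
- by exists (g @^-1` D) => //; apply: open_comp => // s _; exact: cg.
- exists (g @^-1` closure D).
    by apply: closed_comp => [s _|]; [exact: cg|exact: closed_closure].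
  apply/seteqP; split=> s [s01 /= Ds]; split=> //; first exact: subset_closure.
  by apply: contrapT => nDs; apply: noB; exists s; rewrite ?open_bdryE.
Qed.

(** Every line through a small cube around p, in the direction q - p, meets
D first and its exterior later, hence its boundary in between. Projecting along
q - p to a coordinate hyperplane, the boundary therefore covers a cube of
dimension n. *)
Lemma bdry_cube_gt0 n (D : set 'rV[R]_n.+1) x r p q : open D -> 0 < r ->
  D p -> cube x r p -> ~ closure D q -> cube x r q ->
  hausdorff n (bdry D `&` cube x (2 * r)) != 0%E.
Proof.
move=> oD r0 Dp xp Dq xq.
have [rp rp0 pD] := open_cube oD Dp.
have oC : open (~` closure D) by rewrite openC; exact: closed_closure.
have [rq rq0 qD] := open_cube oC Dq.
pose rho := Num.min r (Num.min rp rq).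
have rho0 : 0 < rho by rewrite !lt_min r0 rp0.
have [rhor rhop rhoq] : [/\ rho <= r, rho <= rp & rho <= rq].
  by split; rewrite /rho !ge_min lexx ?orbT.
have [j wj] : exists j, q ord0 j - p ord0 j != 0.
  apply: contrapT => /forallNP H; apply: Dq; apply: subset_closure.
  suff <- : p = q by [].
  by apply/rowP => j; apply/eqP; have /negP := H j; rewrite negbK subr_eq0 eq_sym.
(* The projection along q - p onto the hyperplane where coordinate j is 0. *)
pose t i := (q ord0 (lift j i) - p ord0 (lift j i)) / (q ord0 j - p ord0 j).
pose pr (y : 'rV[R]_n.+1) : 'rV[R]_n :=
  \row_i (y ord0 (lift j i) - y ord0 j * t i).
pose L := 1 + \sum_i `|t i|.
have L0 : 0 < L by rewrite ltr_pwDl // sumr_ge0.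
have prL y z i : `|pr y ord0 i - pr z ord0 i| <= L * enorm (y - z).
  have -> : pr y ord0 i - pr z ord0 i =
      (y - z) ord0 (lift j i) - (y - z) ord0 j * t i by rewrite !mxE; ring.
  rewrite (le_trans (ler_normB _ _)) // /L mulrDl mul1r lerD ?le_enorm //.
  rewrite normrM mulrC ler_pM ?le_enorm //.
  by rewrite (bigD1 i) //= lerDl sumr_ge0.
apply: (hausdorff_gt0 L0 prL rho0 (c := pr p)) => z zp.
(* Translate p and q inside the hyperplane so that they project to z. *)
have [h [hj hl]] : exists h : 'rV[R]_n.+1, h ord0 j = 0 /\
    forall i, h ord0 (lift j i) = z ord0 i - pr p ord0 i.
  exists (\row_k oapp (fun i => z ord0 i - pr p ord0 i) 0 (unlift j k)).
  by split=> [|i]; rewrite mxE ?unlift_none ?liftK.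
have hrho k : `|h ord0 k| <= rho.
  case: (unliftP j k) => [i|] ->; first by rewrite hl; exact: zp.
  by rewrite hj normr0 ltW.
have Dph : D (p + h).
  apply: pD => k; by rewrite mxE addrAC subrr add0r (le_trans (hrho k)).
have Dqh : ~ closure D (q + h).
  by apply: qD => k; rewrite mxE addrAC subrr add0r (le_trans (hrho k)).
have [s s01 Ds] := segment_meets_bdry oD Dph Dqh.
exists (p + h + s *: (q + h - (p + h))).
  split=> // k; rewrite !mxE; have := xp k; have := xq k; have := hrho k.
  move: s01 => /andP[s0 s1]; rewrite ler_norml !ler_distl.
  move=> /andP[h1 h2] /andP[q1 q2] /andP[p1 p2].
  have s1' : 0 <= 1 - s by rewrite subr_ge0.
  have := mulr_ge0 s1' (_ : 0 <= p ord0 k - (x ord0 k - r)).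
  have := mulr_ge0 s1' (_ : 0 <= (x ord0 k + r) - p ord0 k).
  have := mulr_ge0 s0 (_ : 0 <= q ord0 k - (x ord0 k - r)).
  have := mulr_ge0 s0 (_ : 0 <= (x ord0 k + r) - q ord0 k).
  rewrite !subr_ge0 => /(_ q2) e1 /(_ q1) e2 /(_ p2) e3 /(_ p1) e4.
  by apply/andP; split; lra.
apply/rowP => i; rewrite !mxE hj hl !mxE /t.
by field.
Qed.

(** If the part of the boundary of D inside Omega were null, then near each
point of Omega D would be dense or absent, so its closure would be relatively
open and closed in the connected set C, leaving no room for D'. *)
Lemma bdry_between_gt0 n (Omega C D D' : set 'rV[R]_n.+1) :
  open Omega -> C `<=` Omega -> connected C ->
  open D -> open D' -> D `&` C !=set0 -> D' `&` C !=set0 ->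
  D `&` D' = set0 ->
  hausdorff n (bdry D `&` Omega) != 0%E.
Proof.
move=> oO CO cC oD oD' [a [Da Ca]] [b [D'b Cb]] DD'; apply/eqP => null.
have dichotomy x : Omega x -> closure D x -> (closure D)^° x.
  move=> Ox clx; have [r r0 xrO] := open_cube oO Ox.
  have r20 : 0 < r / 2 by rewrite divr_gt0.
  have [p [Dp xp]] := clx _ (cube_open_nbhs x r20).
  apply: filterS (cube_open_nbhs x r20) => q xq.
  apply: contrapT => Dq.
  have /negP := bdry_cube_gt0 oD r20 Dp xp Dq xq; apply.
  rewrite eq_le outer_measure_ge0 andbT -[leRHS]null; apply: le_outer_measure => y [By xy].
  by split => //; apply: xrO => i; rewrite (le_trans (xy i)) // mulrC divfK.
have CE : C `&` closure D = C.
  apply: cC.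
  - by exists a; split=> //; exact: subset_closure.
  - exists (closure D)^°; first exact: open_interior.
    apply/seteqP; split=> x [Cx Dx]; split=> //.
      by apply: dichotomy => //; exact: CO.
    exact: interior_subset.
  - by exists (closure D) => //; exact: closed_closure.
have : closure D b by move: Cb; rewrite -{1}CE => -[].
move=> /(_ D' (open_nbhs_nbhs (conj oD' D'b)))[y [Dy D'y]].
by have : (D `&` D') y by []; rewrite DD'.
Qed.

(** Another element shares the component of T i, so the boundary of T i inside
Omega is not null. The edges cover bdry (T i) up to a null set, hence one of
them meets Omega, and such an edge lies in Omega entirely. *)
Lemma interior_edge d (Omega : set 'rV[R]_d) (I : finType)
    (T : I -> set 'rV[R]_d) (E : I -> set (set 'rV[R]_d)) i :
  (0 < d)%N -> open Omega -> is_partition Omega T E ->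
  components_have_two_elements Omega T ->
  exists2 e, E i e & e `<=` bdry (T i) `\` bdry Omega.
Proof.
case: d => // n in Omega T E i * => _ oO [elt TO disj _ edges] two.
have [[oT [x Tx] cT _ _] _ _ eT null] := elt i.
have Ox : Omega x by exact: TO Tx.
have [j1 [j2 [j12 Tj1 Tj2]]] := two x Ox.
have [j ji Tj] : exists2 j, i != j & T j `<=` connected_component Omega x.
  by have [ij|ij] := eqVneq i j1; [exists j2; rewrite // ij|exists j1].
have [[oTj [y Ty] _ _ _] _ _ _ _] := elt j.
apply: contrapT => noedge.
suff : hausdorff n (bdry (T i) `&` Omega) = 0%E.
  apply/eqP.
  apply: (bdry_between_gt0 oO (@connected_component_sub _ Omega x)
    (@component_connected _ Omega x) oT oTj _ _ (disj _ _ ji)).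
    by exists x; split=> //; exact: connected_component_refl.
  by exists y; split=> //; exact: Tj.
apply/eqP; rewrite eq_le outer_measure_ge0 andbT -[leRHS]null.
apply: le_outer_measure => z [Bz Oz]; split=> // -[e Ee ez].
have [_ _ [U _ eU]] := eT _ Ee.
have [eO|eB] := edges _ _ Ee; last first.
  by have := eB _ ez; rewrite open_bdryE // => -[].
apply: noedge; exists e => // u eu; split.
  by move: eu; rewrite eU => -[].
by rewrite open_bdryE // => -[_]; apply; exact: eO.
Qed.
End interface.

(** * Integrals of real functions *)

Section real_integrals.
Context dd (X : measurableType dd) (R : realType).
Context (mu : {measure set X -> \bar R}) (D : set X).
Hypothesis mD : measurable D.
Implicit Types f g : X -> R.

Lemma integrable_ae_bounded f g (M : R) : measurable_fun D f ->
  {ae mu, forall x, D x -> `|f x| <= M} ->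
  mu.-integrable D (EFin \o g) ->
  mu.-integrable D (EFin \o (fun x => f x * g x)).
Proof.
move=> mf fM /integrableP[/measurable_EFinP mg ig].
have mfg : measurable_fun D (fun x => f x * g x) by exact: measurable_funM.
apply/integrableP; split; first exact/measurable_EFinP.
apply: (@le_lt_trans _ _ (\int[mu]_(x in D) ((`|M|)%:E * `|(g x)%:E|))%E).
  apply: ae_ge0_le_integral => //.
  - by apply: measurableT_comp => //; exact/measurable_EFinP.
  - apply: measurable_funeM; apply: measurableT_comp => //.
    exact/measurable_EFinP.
  - apply: filterS fM => x fM Dx.
    rewrite /= normrM EFinM lee_pmul ?lee_fin //.
    exact: le_trans (fM Dx) (ler_norm _).
rewrite ge0_integralZl //.
  by rewrite lte_mul_pinfty.
by apply: measurableT_comp => //; exact/measurable_EFinP.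
Qed.

(** The bounds on the coefficients hold almost everywhere only, so integrals are
compared under almost everywhere inequalities. *)
Lemma ae_Rintegral_ge0 f : mu.-integrable D (EFin \o f) ->
  {ae mu, forall x, D x -> 0 <= f x} -> 0 <= \int[mu]_(x in D) f x.
Proof.
move=> fi f0; have /measurable_EFinP mf := measurable_int _ fi.
rewrite /Rintegral (@ae_eq_integral _ _ _ _ _ (fun x => (`|f x|)%:E)) //.
- by apply: fine_ge0; apply: integral_ge0 => x _; rewrite lee_fin.
- exact/measurable_EFinP.
- by apply/measurable_EFinP; apply: measurableT_comp.
- by apply: filterS f0 => x f0 Dx; rewrite ger0_norm // f0.
Qed.

Lemma ae_le_Rintegral f g :
  mu.-integrable D (EFin \o f) -> mu.-integrable D (EFin \o g) ->
  {ae mu, forall x, D x -> f x <= g x} ->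
  \int[mu]_(x in D) f x <= \int[mu]_(x in D) g x.
Proof.
move=> fi gi fg; rewrite -subr_ge0 -RintegralB //.
apply: ae_Rintegral_ge0; first exact: (integrableB mD gi fi).
by apply: filterS fg => x fg Dx; rewrite subr_ge0 fg.
Qed.

Lemma Rintegral_partition (I : finType) (T : I -> set X) f :
  (forall i, measurable (T i)) -> (forall i, T i `<=` D) ->
  (forall i j, i != j -> T i `&` T j = set0) ->
  mu (D `\` \bigcup_i T i) = 0%E ->
  mu.-integrable D (EFin \o f) ->
  \int[mu]_(x in D) f x = \sum_i \int[mu]_(x in T i) f x.
Proof.
move=> mT TD disj null fi.
have mU : measurable (\bigcup_i T i) by exact: fin_bigcup_measurable.
have UD : \bigcup_i T i `<=` D by move=> x [i _ Tx]; exact: TD Tx.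
rewrite /Rintegral (negligible_integral _ _ fi null) ?setDD ?setIidr//; last first.
  exact: measurableD.
have UE : \bigcup_i T i = \big[setU/set0]_(i <- index_enum I) T i.
  rewrite -bigcup_seq; apply: eq_bigcupl; split=> i _ //=.
  exact: mem_index_enum.
rewrite UE integral_bigsetU_EFin ?index_enum_uniq //.
- rewrite sum_fine // => i _; apply: integrable_fin_num => //.
  exact: integrableS fi.
- by apply/trivIsetP => i j _ _; exact: disj.
- rewrite -UE; exact: measurable_funS UD (measurable_int _ fi).
Qed.
End real_integrals.

Lemma normc_sqr (R : realType) (z : R[i]) :
  normc z ^+ 2 = Re z ^+ 2 + Im z ^+ 2.
Proof. by case: z => a b /=; rewrite sqr_sqrtr // addr_ge0 ?sqr_ge0. Qed.

(** With a, b the two terms of the energy, g, m, F the squared norms of the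
gradient, of the function and of the source: the resolution condition makes
b at most a / 2, so the indefinite form a - b controls a; Poincare's inequality
then absorbs m / t in a for t of the order of c ^+ 2 / Amin. *)
Lemma absorption (R : realType) (a b g m F Amin W c : R) :
  0 < Amin -> 0 <= W -> 0 <= F ->
  Amin * g <= a -> b <= W * m -> m <= c ^+ 2 * g -> 2 * W * c ^+ 2 <= Amin ->
  0 <= g ->
  (forall t, 0 < t -> a - b <= (t * F + m / t) / 2) ->
  a + b <= 9 * c ^+ 2 / Amin * F.
Proof.
move=> A0 W0 F0 ga bm mg cond g0 young.
set k := c ^+ 2 / Amin.
have kA : k * Amin = c ^+ 2 by rewrite /k divfK // gt_eqF.
have k0 : 0 <= k by rewrite divr_ge0 ?sqr_ge0 ?ltW.
have ma : m <= k * a by rewrite (le_trans mg) // -kA -mulrA ler_wpM2l.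
have ba : 2 * b <= a.
  have : W * m <= W * (c ^+ 2 * g) by rewrite ler_wpM2l.
  have : 2 * W * c ^+ 2 * g <= Amin * g by rewrite ler_wpM2r.
  by lra.
have -> : 9 * c ^+ 2 / Amin * F = 9 * (k * F) by rewrite /k; ring.
have kF : 0 <= k * F by rewrite mulr_ge0.
(* For k = 0 no single weight is optimal; a small one proves a <= 0. *)
move: k0; rewrite le_eqVlt => /predU1P[kz|k0].
  suff : a <= 0 by lra.
  rewrite leNgt; apply/negP => a0.
  have F1 : 0 < F + 1 by lra.
  have t0 : 0 < a / (F + 1) by rewrite divr_gt0.
  have := young _ t0.
  have -> : a / (F + 1) * F = a - a / (F + 1) by field; lra.
  have : m / (a / (F + 1)) <= 0.
    by rewrite ler_pdivrMr // mul0r (le_trans ma) // -kz mul0r.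
  by lra.
have := young (2 * k) (mulr_gt0 (ltr0Sn R 1) k0).
have : m / (2 * k) <= a / 2.
  have -> : a / 2 = k * a / (2 * k) by field; rewrite gt_eqF.
  by rewrite ler_pM2r // invr_gt0 mulr_gt0.
by lra.
Qed.

(** * Squared moduli of complex functions *)

Section complex_functions.
Context dd (X : measurableType dd) (R : realType) (D : set X).

Lemma mulcJ (z : R[i]) : z * z^*%C = (normc z ^+ 2)%:C%C.
Proof.
rewrite normc_sqr; case: z => a b; apply/eqP; rewrite eq_complex /=.
by apply/andP; split; apply/eqP; ring.
Qed.

Lemma measurable_normc_sqr (f : X -> R[i]) : cmeasurable_fun D f ->
  measurable_fun D (fun x => normc (f x) ^+ 2).
Proof.
move=> [mRe mIm]; under eq_fun do rewrite normc_sqr.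
by apply: measurable_funD; exact: measurable_funX.
Qed.

(** Complete squares in t z + s w, where the sign s gives the two bounds that
make up the one on the modulus. *)
Lemma Re_mulJ_young (z w : R[i]) t : 0 < t ->
  `|Re (z * w^*%C)| <= (t * normc z ^+ 2 + normc w ^+ 2 / t) / 2.
Proof.
move=> t0; rewrite !normc_sqr; case: z w => [a b] [c d] /=.
have e (s : R) : 0 <= (t * a + s * c) ^+ 2 + (t * b + s * d) ^+ 2.
  by rewrite addr_ge0 ?sqr_ge0.
have h (s : R) : s ^+ 2 = 1 ->
    - s * (a * c + b * d) <= (t * (a ^+ 2 + b ^+ 2) + (c ^+ 2 + d ^+ 2) / t) / 2.
  move=> s2; rewrite -subr_ge0.
  have -> : (t * (a ^+ 2 + b ^+ 2) + (c ^+ 2 + d ^+ 2) / t) / 2 -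
      - s * (a * c + b * d) =
      ((t * a + s * c) ^+ 2 + (t * b + s * d) ^+ 2) / (2 * t) +
      (1 - s ^+ 2) * (c ^+ 2 + d ^+ 2) / (2 * t) by field; rewrite gt_eqF.
  by rewrite s2 subrr !mul0r addr0 divr_ge0 // mulr_ge0 // ltW.
have := h 1 (expr1n _ _); have := h (-1) (etrans (sqrrN 1) (expr1n _ _)).
rewrite ler_norml mulrN opprK; lra.
Qed.

End complex_functions.

(** * Energy of the bubble on an element *)

Section energy.
Context (R : realType) (d : nat).
Local Notation Rd := 'rV[R]_d.
Local Notation leb := (lebesgue_rV R d).
Implicit Types (D : set Rd) (u f : Rd -> R[i]) (G : Rd -> 'rV[R[i]]_d).

Lemma in_L2S D D' u : measurable D -> measurable D' -> D' `<=` D ->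
  in_L2 D u -> in_L2 D' u.
Proof.
move=> mD mD' DD' [mu_ fin]; split.
  by case: mu_ => ? ?; split; apply: measurable_funS DD' _.
apply: le_lt_trans fin; apply: ge0_subset_integral => //.
  by apply/measurable_EFinP; exact: measurable_normc_sqr.
by move=> x _; rewrite lee_fin sqr_ge0.
Qed.

Lemma in_L2_integrable D u : in_L2 D u ->
  leb.-integrable D (EFin \o (fun x => normc (u x) ^+ 2)).
Proof.
move=> [mu_ fin]; apply/integrableP; split.
  by apply/measurable_EFinP; exact: measurable_normc_sqr.
rewrite (eq_integral (fun x => (normc (u x) ^+ 2)%:E)) // => x _.
by rewrite /= ger0_norm // sqr_ge0.
Qed.

Lemma sqnormc_integrable D G : measurable D ->
  (forall j, in_L2 D (fun x => G x ord0 j)) ->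
  leb.-integrable D (EFin \o (fun x => sqnormc (G x))).
Proof.
move=> mD GL2.
have := integrable_sum mD (index_enum 'I_d) (P := xpredT)
  (fun j _ => in_L2_integrable (GL2 j)).
by apply: eq_integrable => // x _; rewrite /= /sqnormc sumEFin.
Qed.

Lemma cmeasurable_Re_mulJ D f u : cmeasurable_fun D f -> cmeasurable_fun D u ->
  measurable_fun D (fun x => Re (f x * (u x)^*%C)).
Proof.
move=> [fR fI] [uR uI].
rewrite (_ : (fun x => _) = fun x => Re (f x) * Re (u x) + Im (f x) * Im (u x)).
  by apply: measurable_funD; exact: measurable_funM.
by apply/funext => x; case: (f x) (u x) => [a b] [c e] /=; rewrite mulrN opprK.
Qed.

Lemma Re_mulJ_integrable D f u : measurable D -> in_L2 D f -> in_L2 D u ->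
  leb.-integrable D (EFin \o (fun x => Re (f x * (u x)^*%C))).
Proof.
move=> mD fL2 uL2.
have := integrableD mD (in_L2_integrable fL2) (in_L2_integrable uL2).
apply: le_integrable => //.
  apply/measurable_EFinP; apply: cmeasurable_Re_mulJ; first by case: fL2.
  by case: uL2.
move=> x _ /=; rewrite lee_fin [leRHS]ger0_norm ?addr_ge0 ?sqr_ge0 //.
apply: (le_trans (Re_mulJ_young (f x) (u x) ltr01)).
have := sqr_ge0 (normc (f x)); have := sqr_ge0 (normc (u x)).
by rewrite mul1r divr1; lra.
Qed.

Lemma grad_term_integrable D (A : Rd -> R) G Amin Amax : measurable D ->
  measurable_fun D A -> 0 < Amin ->
  {ae leb, forall x, D x -> Amin <= A x <= Amax} ->
  leb.-integrable D (EFin \o (fun x => sqnormc (G x))) ->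
  leb.-integrable D (EFin \o (fun x => A x * sqnormc (G x))).
Proof.
move=> mD mA Amin0 Abnd.
apply: (@integrable_ae_bounded _ _ _ _ _ mD _ _ Amax) => //.
apply: filterS Abnd => x + Dx => /(_ Dx)/andP[A1 A2].
by rewrite ger0_norm // (le_trans _ A1) // ltW.
Qed.

Lemma potential_bound k D (V : Rd -> R) Vmin Vmax : 0 < Vmin ->
  {ae leb, forall x, D x -> Vmin <= V x <= Vmax} ->
  {ae leb, forall x, D x -> k ^+ 2 * V x ^+ 2 <= k ^+ 2 * Vmax ^+ 2}.
Proof.
move=> Vmin0; apply: filterS => x + Dx => /(_ Dx)/andP[V1 V2].
rewrite ler_wpM2l ?sqr_ge0 // ler_sqr ?nnegrE //.
  by rewrite (le_trans _ V1) // ltW.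
by rewrite (le_trans _ (le_trans V1 V2)) // ltW.
Qed.

Lemma mass_term_integrable k D (V : Rd -> R) u Vmin Vmax : measurable D ->
  measurable_fun D V -> 0 < Vmin ->
  {ae leb, forall x, D x -> Vmin <= V x <= Vmax} ->
  leb.-integrable D (EFin \o (fun x => normc (u x) ^+ 2)) ->
  leb.-integrable D
    (EFin \o (fun x => k ^+ 2 * V x ^+ 2 * normc (u x) ^+ 2)).
Proof.
move=> mD mV Vmin0 Vbnd.
apply: (@integrable_ae_bounded _ _ _ _ _ mD _ _ (k ^+ 2 * Vmax ^+ 2)).
  by apply: measurable_funM => //; exact: measurable_funX.
apply: filterS (potential_bound k Vmin0 Vbnd) => x + Dx => /(_ Dx) Wx.
by rewrite ger0_norm // mulr_ge0 ?sqr_ge0.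
Qed.

(** When u itself is the test function, the Robin term is purely imaginary and
vanishes from the real part of the weak form. *)
Lemma bubble_energy_identity k A beta V GammaN GammaR f D u G :
  bubble_on k A beta V GammaN GammaR f D u G ->
  \int[leb]_(x in D) (A x * sqnormc (G x) -
     k ^+ 2 * V x ^+ 2 * normc (u x) ^+ 2) =
  \int[leb]_(x in D) Re (f x * (u x)^*%C).
Proof.
move=> [uH1 [g [tr van weak]]].
have := congr1 (@complex.Re R) (weak u G g uH1 tr van); rewrite /cintegral /= => <-.
rewrite [X in _ = _ - X](_ : _ = 0); last first.
  rewrite /Rintegral integral0_eq // => x _; congr EFin.
  rewrite /Tk; case: asboolP => _; last by rewrite mul0r.
  by case: (g x) => a b /=; ring.
rewrite subr0; apply: eq_Rintegral => x _.
rewrite (eq_bigr _ (fun j _ => mulcJ (G x ord0 j))) -rmorph_sum /=.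
by rewrite -[in RHS]mulrA mulcJ -!rmorphM -rmorphB.
Qed.

(** Here c stands for C_P H, and the condition on it is the square of the bound
on the mesh size, in a form that makes sense whatever the sign of Vmax. The
integrals of the five densities satisfy the hypotheses of [absorption]. *)
Lemma bubble_energy_le k A beta V GammaN GammaR f D u G
    (Amin Amax Vmin Vmax c : R) :
  measurable D -> measurable_fun D A -> measurable_fun D V ->
  0 < Amin -> 0 < Vmin ->
  {ae leb, forall x, D x -> Amin <= A x <= Amax} ->
  {ae leb, forall x, D x -> Vmin <= V x <= Vmax} ->
  in_L2 D f -> 0 <= c -> 2 * (k ^+ 2 * Vmax ^+ 2) * c ^+ 2 <= Amin ->
  bubble_on k A beta V GammaN GammaR f D u G ->
  L2norm D u <= c * L2norm_grad D G ->
  \int[leb]_(x in D) (A x * sqnormc (G x) +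
     k ^+ 2 * V x ^+ 2 * normc (u x) ^+ 2) <=
  9 * c ^+ 2 / Amin * \int[leb]_(x in D) normc (f x) ^+ 2.
Proof.
move=> mD mA mV Amin0 Vmin0 Abnd Vbnd fL2 c0 cond bub poinc.
have [[uL2 GL2 _] _] := bub.
have iG := sqnormc_integrable mD GL2.
have iu := in_L2_integrable uL2.
have iF := in_L2_integrable fL2.
have iAG := grad_term_integrable mD mA Amin0 Abnd iG.
have iWu := mass_term_integrable k mD mV Vmin0 Vbnd iu.
have Wbnd := potential_bound k Vmin0 Vbnd.
set W := k ^+ 2 * Vmax ^+ 2 in cond Wbnd.
rewrite RintegralD //; apply: (absorption (g := \int[leb]_(x in D) sqnormc (G x))
  (m := \int[leb]_(x in D) normc (u x) ^+ 2) Amin0 _ _ _ _ _ cond).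
- by rewrite mulr_ge0 ?sqr_ge0.
- by apply: Rintegral_ge0 => x _; exact: sqr_ge0.
- rewrite -RintegralZl //; apply: ae_le_Rintegral => //.
    exact: (integrableZl mD Amin iG).
  apply: filterS Abnd => x + Dx => /(_ Dx)/andP[A1 A2].
  by rewrite ler_wpM2r // sumr_ge0 // => j _; exact: sqr_ge0.
- rewrite -RintegralZl //; apply: ae_le_Rintegral => //.
    exact: (integrableZl mD W iu).
  by apply: filterS Wbnd => x + Dx => /(_ Dx) Wx; rewrite ler_wpM2r ?sqr_ge0.
- have g0 : 0 <= \int[leb]_(x in D) sqnormc (G x).
    apply: Rintegral_ge0 => x _; apply: sumr_ge0 => j _; exact: sqr_ge0.
  have m0 : 0 <= \int[leb]_(x in D) normc (u x) ^+ 2.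
    by apply: Rintegral_ge0 => x _; exact: sqr_ge0.
  rewrite -(sqr_sqrtr g0) -(sqr_sqrtr m0) -exprMn ler_sqr ?nnegrE ?sqrtr_ge0 //.
  by rewrite mulr_ge0 ?sqrtr_ge0.
- by apply: Rintegral_ge0 => x _; apply: sumr_ge0 => j _; exact: sqr_ge0.
move=> t t0; rewrite -RintegralB // (bubble_energy_identity bub).
have itF := integrableZl mD t iF.
have iut := integrableZl mD t^-1 iu.
have iY := integrableZl mD 2^-1 (integrableD mD itF iut).
have -> : (t * \int[leb]_(x in D) normc (f x) ^+ 2 +
    (\int[leb]_(x in D) normc (u x) ^+ 2) / t) / 2 =
    \int[leb]_(x in D) (2^-1 * (t * normc (f x) ^+ 2 + t^-1 * normc (u x) ^+ 2)).
  rewrite RintegralZl //; last exact: (integrableD mD itF iut).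
  by rewrite RintegralD // !RintegralZl // mulrC [_ / t]mulrC.
apply: le_Rintegral => //; first exact: Re_mulJ_integrable.
move=> x _; rewrite (le_trans (ler_norm _)) //.
by rewrite (le_trans (Re_mulJ_young _ _ t0)) // mulrC [_ / t]mulrC.
Qed.

End energy.

(** * The estimate on the whole domain *)

Lemma vanishes_onS (R : realType) d (S S' : set 'rV[R]_d) (g : 'rV[R]_d -> R[i]) :
  S' `<=` S -> vanishes_on S g -> vanishes_on S' g.
Proof.
move=> SS' gS; apply/eqP; rewrite eq_le outer_measure_ge0 andbT -[leRHS]gS.
by apply: le_outer_measure; exact: setSI.
Qed.

(** Only Vmax > 0 gives the hypothesis its usual reading. For Vmax < 0 it is
contradictory, and for Vmax = 0 the conclusion is trivial. *)
Lemma resolution_condition (R : realType) (Amin CP Vmax k H : R) :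
  0 < Amin -> 0 < CP -> 0 < k -> 0 <= H ->
  H <= Num.sqrt Amin / (Num.sqrt 2 * CP * Vmax * k) ->
  2 * (k ^+ 2 * Vmax ^+ 2) * (CP * H) ^+ 2 <= Amin.
Proof.
move=> A0 CP0 k0 H0; have s20 : 0 < Num.sqrt 2 :> R by rewrite sqrtr_gt0.
have c0 : 0 < Num.sqrt 2 * CP * k by rewrite !mulr_gt0.
have [V0|V0|->] := ltgtP Vmax 0.
- move=> /(le_trans H0); rewrite leNgt => /negP[].
  by rewrite pmulr_rlt0 ?sqrtr_gt0 // invr_lt0 mulrAC pmulr_rlt0.
- rewrite ler_pdivlMr ?mulr_gt0 // => HQ.
  have -> : 2 * (k ^+ 2 * Vmax ^+ 2) * (CP * H) ^+ 2 =
      (H * (Num.sqrt 2 * CP * Vmax * k)) ^+ 2.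
    by rewrite -{1}(sqr_sqrtr (ler0n R 2)); ring.
  rewrite -[leRHS](sqr_sqrtr (ltW A0)) ler_sqr ?nnegrE ?sqrtr_ge0 //.
  by rewrite mulr_ge0 // ltW // !mulr_gt0.
by move=> _; rewrite expr0n /= mulr0 mulr0 mul0r ltW.
Qed.

Theorem proposition3p4 (R : realType) (d : nat) (d_gt0 : (0 < d)%N)
  (Omega GammaD GammaN GammaR : set 'rV[R]_d)
  (Omega_open : open Omega) (Omega_bounded : bounded_set Omega)
  (Omega_lipschitz : lipschitz_boundary Omega)
  (bdry_Omega : bdry Omega = GammaD `|` GammaN `|` GammaR)
  (GammaDN : GammaD `&` GammaN = set0) (GammaDR : GammaD `&` GammaR = set0)
  (GammaNR : GammaN `&` GammaR = set0)
  (GammaD_meas : measurable (GammaD : set (surface_type R d)))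
  (GammaN_meas : measurable (GammaN : set (surface_type R d)))
  (GammaR_meas : measurable (GammaR : set (surface_type R d)))
  (k : R) (k_gt0 : 0 < k)
  (A beta V : 'rV[R]_d -> R) (Amin Amax bmin bmax Vmin Vmax : R)
  (A_meas : measurable_fun Omega A) (V_meas : measurable_fun Omega V)
  (beta_meas : measurable_fun (GammaR : set (surface_type R d)) beta)
  (Amin_gt0 : 0 < Amin) (bmin_gt0 : 0 < bmin) (Vmin_gt0 : 0 < Vmin)
  (A_bounds : {ae lebesgue_rV R d,
     forall x, Omega x -> Amin <= A x <= Amax})
  (V_bounds : {ae lebesgue_rV R d,
     forall x, Omega x -> Vmin <= V x <= Vmax})
  (beta_bounds : {ae surface R d,
     forall x, GammaR x -> bmin <= beta x <= bmax})
  (I : finType) (T : I -> set 'rV[R]_d) (E : I -> set (set 'rV[R]_d))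
  (H c0 c1 : R) (c0_gt0 : 0 < c0) (c1_gt0 : 0 < c1)
  (TE_partition : is_partition Omega T E)
  (T_regular : shape_regular_uniform T H c0 c1)
  (T_components : components_have_two_elements Omega T)
  (CP : R) (CP_gt0 : 0 < CP) (CP_poincare : poincare_constant T E H CP)
  (H_le : H <= Num.sqrt Amin / (Num.sqrt 2 * CP * Vmax * k))
  (f : 'rV[R]_d -> R[i]) (f_L2 : in_L2 Omega f)
  (ub : 'rV[R]_d -> R[i]) (Gub : 'rV[R]_d -> 'rV[R[i]]_d)
  (ub_HOmega : in_HOmega Omega GammaD ub Gub)
  (ub_bubble : forall i, bubble_on k A beta V GammaN GammaR f (T i) ub Gub) :
  energy_norm Omega k A V ub Gub
    <= 3 * CP / Num.sqrt Amin * H * L2norm Omega f.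
Proof.
have mOmega := open_measurable_rV Omega_open.
have [elt TO disj null _] := TE_partition.
have mT i : measurable (T i).
  by have [[oT _ _ _ _] _ _ _ _] := elt i; exact: open_measurable_rV.
have H_ge0 : 0 <= H by have [_ [i <-] _ _] := T_regular; exact: diam_ge0.
have CPH_ge0 : 0 <= CP * H by rewrite mulr_ge0 // ltW.
have cond := resolution_condition Amin_gt0 CP_gt0 k_gt0 H_ge0 H_le.
have poincare i : L2norm (T i) ub <= CP * H * L2norm_grad (T i) Gub.
  have [e Ee eT] := interior_edge i d_gt0 Omega_open TE_partition T_components.
  have [uH1 [g [tr van _]]] := ub_bubble i.
  apply: CP_poincare Ee uH1 tr _; apply: vanishes_onS van => x /eT[Bx nBx].
  split=> // nat; apply: nBx; rewrite bdry_Omega -setUA; right; exact: nat.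
have [[uL2 GL2 _] _] := ub_HOmega.
have iE : (lebesgue_rV R d).-integrable Omega (EFin \o (fun x =>
    A x * sqnormc (Gub x) + k ^+ 2 * V x ^+ 2 * normc (ub x) ^+ 2)).
  exact: (integrableD mOmega
    (grad_term_integrable mOmega A_meas Amin_gt0 A_bounds
      (sqnormc_integrable mOmega GL2))
    (mass_term_integrable k mOmega V_meas Vmin_gt0 V_bounds
      (in_L2_integrable uL2))).
have iF := in_L2_integrable f_L2.
pose K := 3 * CP / Num.sqrt Amin * H.
have K_ge0 : 0 <= K by rewrite mulr_ge0 // divr_ge0 ?sqrtr_ge0 // mulr_ge0 // ltW.
have K2 : K ^+ 2 = 9 * (CP * H) ^+ 2 / Amin.
  rewrite /K -[in RHS](sqr_sqrtr (ltW Amin_gt0)).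
  by field; rewrite gt_eqF // sqrtr_gt0.
rewrite -/K -[K]ger0_norm // -sqrtr_sqr /energy_norm /L2norm -sqrtrM ?sqr_ge0 //.
apply: ler_wsqrtr; rewrite K2.
rewrite (Rintegral_partition mOmega mT TO disj null iE).
rewrite (Rintegral_partition mOmega mT TO disj null iF) mulr_sumr.
apply: ler_sum => i _; apply: (bubble_energy_le (mT i) _ _ Amin_gt0 Vmin_gt0
  _ _ _ CPH_ge0 cond (ub_bubble i) (poincare i)).
- exact: measurable_funS (TO i) A_meas.
- exact: measurable_funS (TO i) V_meas.
- by apply: filterS A_bounds => x + Tx; apply; exact: TO Tx.
- by apply: filterS V_bounds => x + Tx; apply; exact: TO Tx.
- exact: in_L2S mOmega (mT i) (TO i) f_L2.
Qed.
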